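(* Let $D_n=(N,A)$ be the complete digraph on $n$ nodes, let $c=(c_1,\dots,c_m)$ be a cardinality sequence, let $P^*=\{x\in P_C^{c}(D_n): x(\delta^{\mathrm{out}}(1))=1\}$, and let $W\subset N$ with $1\in W$ and $c_p<|W|<c_{p+1}$ for some $p\in\{1,\dots,m-1\}$. The cardinality-subgraph inequality \[2x(A(W))-(|W|-c_p-1)\,[x((W:N\setminus W))+x((N\setminus W:W))]\le 2c_p\] is valid for $P^*$, and it induces a facet of $P^*$ if and only if $p+1<m$ or $c_{p+1}=n=|W|+1$.
   Context: $D_n=(N,A)$ is the complete digraph with $N=\{1,\dots,n\}$, $A=\{(i,j):i\ne j\}$. A cardinality sequence is a sequence of integers $1\le c_1<\dots<c_m\le n$. $P_C^{c}(D_n)$ is the convex hull in $\mathbb{R}^A$ of incidence vectors of simple directed cycles of $D_n$ with number of arcs in $\{c_1,\dots,c_m\}$. For $F\subseteq A$, $x(F)=\sum_{(i,j)\in F}x_{ij}$; $\delta^{\mathrm{out}}(i)$ is the set of arcs leaving $i$; for $S,T\subseteq N$, $(S:T)=\{(i,j)\in A: i\in S, j\in T\}$; $A(S)$ is the set of arcs with both endnodes in $S$.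
   Formalization: The facet equivalence is stated for c_p ≥ 2 only (validity for all c); with c_p = 1 it fails since D_n has no 1-arc cycle: for n = 3, c = (1,3), W = {1,2} both 3-cycles are tight, so the face is all of P*. *)

(* Defs.v *)
From HB Require Import structures.
From mathcomp Require Import all_boot all_order all_algebra.

Set Implicit Arguments.
Unset Strict Implicit.
Unset Printing Implicit Defensive.

Import Order.TTheory GRing.Theory Num.Theory.
Local Open Scope ring_scope.

Section Polyhedra.
Variables (R : realFieldType) (V : lmodType R).
Implicit Types (P : V -> Prop) (f : V -> R) (b : R).

Definition convex_hull P (x : V) : Prop :=
  exists (k : nat) (v : 'I_k -> V) (l : 'I_k -> R),
    [/\ forall i, P (v i),
        forall i, 0 <= l i,
        \sum_(i < k) l i = 1
      & x = \sum_(i < k) l i *: v i].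

Definition affinely_independent (k : nat) (v : 'I_k -> V) : Prop :=
  forall l : 'I_k -> R,
    \sum_(i < k) l i = 0 -> \sum_(i < k) l i *: v i = 0 -> forall i, l i = 0.

(* The dimension is one less than the maximal number of affinely independent
   points, so that the empty set has dimension -1. *)
Definition has_dim P (d : int) : Prop :=
  exists k : nat,
    [/\ d = k%:Z - 1,
        exists v : 'I_k -> V, (forall i, P (v i)) /\ affinely_independent v
      & forall (j : nat) (v : 'I_j -> V),
          (forall i, P (v i)) -> affinely_independent v -> (j <= k)%N].

Definition valid_ineq P f b : Prop := forall x, P x -> f x <= b.

Definition face P f b : V -> Prop := fun x => P x /\ f x = b.

(* Meant for an inequality [f x <= b] that is valid for [P]. *)
Definition induces_facet P f b : Prop :=
  exists d : int, has_dim P d /\ has_dim (face P f b) (d - 1).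

End Polyhedra.

(* The complete digraph D_n; node i of {1, ..., n} is the ordinal i - 1. *)
Section CompleteDigraph.
Variable n : nat.

Definition adj : rel 'I_n := [rel i j | i != j].

Definition darc : Type := {a : 'I_n * 'I_n | adj a.1 a.2}.
HB.instance Definition _ := Finite.on darc.

Definition arc_tail (a : darc) : 'I_n := (val a).1.
Definition arc_head (a : darc) : 'I_n := (val a).2.

Definition delta_out (i : 'I_n) : {set darc} := [set a | arc_tail a == i].

Definition arcs_from_to (S T : {set 'I_n}) : {set darc} :=
  [set a | (arc_tail a \in S) && (arc_head a \in T)].

Definition arcs_inside (S : {set 'I_n}) : {set darc} := arcs_from_to S S.

(* [s] lists the nodes in the order in which the cycle visits them. As [adj] is
   irreflexive, [ucycle adj s] excludes one-node sequences. *)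
Definition simple_dicycle (F : {set darc}) : Prop :=
  exists s : seq 'I_n,
    [/\ s != [::],
        ucycle adj s
      & F = [set a | (arc_tail a \in s) && (arc_head a == next s (arc_tail a))]].

Definition cardinality_sequence (c : seq nat) : bool :=
  sorted ltn c && all (fun k => 1 <= k <= n)%N c.

End CompleteDigraph.

(* The entry c_p of c = (c_1, ..., c_m), where m = size c and 1 <= p <= m. *)
Definition entry (c : seq nat) (p : nat) : nat := nth 0%N c p.-1.

Section CyclePolytope.
Variables (R : realFieldType) (n : nat).

Notation arcvec := {ffun darc n -> R^o}.

Definition arc_sum (x : arcvec) (F : {set darc n}) : R := \sum_(a in F) x a.

Definition incidence (F : {set darc n}) : arcvec := [ffun a => (a \in F)%:R].

Definition cycle_polytope (c : seq nat) : arcvec -> Prop :=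
  convex_hull (fun x => exists F : {set darc n},
    [/\ simple_dicycle F, #|F| \in c & x = incidence F]).

Definition cycle_polytope_through (i : 'I_n) (c : seq nat) : arcvec -> Prop :=
  fun x => cycle_polytope c x /\ arc_sum x (delta_out i) = 1.

Definition cardsubgraph_lhs (W : {set 'I_n}) (cp : nat) (x : arcvec) : R :=
  2 * arc_sum x (arcs_inside W)
  - (#|W|%:R - cp%:R - 1)
    * (arc_sum x (arcs_from_to W (~: W)) + arc_sum x (arcs_from_to (~: W) W)).

End CyclePolytope.

(* Main.v *)
Require Import Defs.
From HB Require Import structures.
From mathcomp Require Import all_boot all_order all_algebra.
From mathcomp Require Import zify ring lra.
Import Order.TTheory GRing.Theory Num.Theory.
Local Open Scope ring_scope.

Set Implicit Arguments.
Unset Strict Implicit.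
Unset Printing Implicit Defensive.

(* Let k = c_p. A cycle with a nodes in W and t arcs leaving W has left-hand side
   2 (a - (|W| - k) t). Since its length is at most k or larger than |W|, this is
   at most 2k, with equality exactly for the cycles of length k inside W and for
   the cycles that traverse all of W and then a nonempty path outside W.

   If c_{p+1} is the largest length, then (length) - (c_{p+1} - k) t = k is a
   second equation on the face, and two cycles off the face show that it is
   independent of the first one, unless c_{p+1} = n = |W| + 1.

   Conversely, let b be a linear functional that vanishes on the tight cycles.
   Contracting the path outside W turns the second kind of tight cycles into the
   Hamiltonian cycles of a complete digraph on |W| + 1 >= 4 nodes, so
   b_ij = phi_i + psi_j unless i and j are both outside W. Up to a potential,
   b_ij depends on j only; the cycles of length k inside W force it to be constant
   on W except at the root, and comparing two lengths of paths outside W (when there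
   are two nodes there) forces b to vanish on arcs outside W. Hence b is a multiple
   of the inequality modulo potentials, and the tight cycles together with one
   cycle that is not tight span the space that P* spans. *)

(** * Sums of arc weights along cycles and paths *)

Section CyclicSums.
Variables (T : eqType) (R : comNzRingType).
Implicit Types (b : T -> T -> R) (s p q : seq T).

Definition cycle_sum b s : R := \sum_(i <- s) b i (next s i).

Fixpoint path_sum b x p : R :=
  if p is y :: p' then b x y + path_sum b y p' else 0.

Lemma path_sum_cat b x p q :
  path_sum b x (p ++ q) = path_sum b x p + path_sum b (last x p) q.
Proof. by elim: p x => [|y p IHp] x /=; rewrite ?add0r // IHp addrA. Qed.

Lemma path_sum_rcons b x p y :
  path_sum b x (rcons p y) = path_sum b x p + b (last x p) y.
Proof. by rewrite -cats1 path_sum_cat /= addr0. Qed.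

Lemma path_sum_nth x0 b x p :
  path_sum b x p = \sum_(0 <= m < size p) b (nth x0 (x :: p) m) (nth x0 p m).
Proof.
elim: p x => [|y p IHp] x /=; first by rewrite big_nil.
by rewrite big_nat_recl // IHp.
Qed.

Lemma cycle_sum_cons b x p : uniq (x :: p) ->
  cycle_sum b (x :: p) = path_sum b x (rcons p x).
Proof.
move=> Us; rewrite /cycle_sum (big_nth x) (path_sum_nth x) size_rcons.
apply: eq_big_nat => m /andP[_ ltm].
rewrite next_nth mem_nth // index_uniq // -rcons_cons !nth_rcons ltm.
by case: ltngtP => // [/ltnW lepm | ->]; rewrite (nth_default x (s := p)).
Qed.

Lemma cycle_sum_rot b n s : uniq s -> cycle_sum b (rot n s) = cycle_sum b s.
Proof.
move=> Us; rewrite /cycle_sum; under eq_bigr do rewrite next_rot //.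
by apply: perm_big; rewrite perm_rot.
Qed.

Lemma sum_next (s : seq T) (F : T -> R) : uniq s ->
  \sum_(i <- s) F (next s i) = \sum_(i <- s) F i.
Proof.
move=> Us; rewrite -(big_map (next s) predT F); apply: perm_big.
have inj_next : injective (next s) by apply: can_inj (prev_next Us).
apply: uniq_perm => //; first by rewrite map_inj_uniq.
move=> x; apply/mapP/idP => [[y sy ->] | sx]; first by rewrite mem_next.
by exists (prev s x); rewrite ?mem_prev ?next_prev.
Qed.

Lemma next_neq s x : uniq s -> (1 < size s)%N -> x \in s -> next s x != x.
Proof.
move=> Us szs sx; have [m s' def_s] := rot_to sx.
rewrite -(next_rot m Us) def_s.
have Us' : uniq (x :: s') by rewrite -def_s rot_uniq.
have : (1 < size (x :: s'))%N by rewrite -def_s size_rot.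
case: s' Us' {def_s} => // y s' /= /andP[]; rewrite inE negb_or eqxx => /andP[].
by rewrite eq_sym.
Qed.

(** The start [x] is the head of no arc of the path, so [tau x] does not occur; distinctness of the
    nodes makes the hypothesis on [b] apply to every arc. *)
Lemma path_sum_head b (tau : T -> R) x p : uniq (x :: p) ->
    (forall i j, i \in x :: p -> j \in x :: p -> i != j -> b i j = tau j) ->
  path_sum b x p = \sum_(j <- p) tau j.
Proof.
elim: p x => [|y p IHp] x; first by rewrite big_nil.
move=> Uxyp tauE; rewrite big_cons /= tauE ?mem_head //.
- rewrite IHp //; first by case/andP: Uxyp.
  by move=> i j pi pj; apply: tauE; rewrite inE ?pi ?pj orbT.
- by rewrite !inE eqxx orbT.
by case/andP: Uxyp; rewrite inE negb_or => /andP[].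
Qed.

Lemma cycle_sum_head b (tau : T -> R) s : uniq s -> (1 < size s)%N ->
    (forall i j, i \in s -> j \in s -> i != j -> b i j = tau j) ->
  cycle_sum b s = \sum_(j <- s) tau j.
Proof.
move=> Us szs tauE; rewrite -(sum_next tau Us) /cycle_sum.
rewrite !big_seq; apply: eq_bigr => i si.
by rewrite tauE ?mem_next // eq_sym next_neq.
Qed.

Lemma cycle_sum_potential (phi : T -> R) s : uniq s ->
  cycle_sum (fun i j => phi i - phi j) s = 0.
Proof. by move=> Us; rewrite /cycle_sum sumrB sum_next // subrr. Qed.

Lemma cycle_sum_cat b x p y q : uniq ((x :: p) ++ y :: q) ->
  cycle_sum b ((x :: p) ++ y :: q) =
  path_sum b x p + b (last x p) y + path_sum b y q + b (last y q) x.
Proof.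
move=> Us; rewrite /= cycle_sum_cons // rcons_cat path_sum_cat /=.
by rewrite path_sum_rcons !addrA.
Qed.

End CyclicSums.

(** * Weights for which all Hamiltonian cycles have the same sum *)

Section HamiltonianExchange.
Variables (T : eqType) (R : realFieldType) (b : T -> T -> R) (D : seq T) (C : R).
Hypothesis sumC : forall s, uniq s -> perm_eq s D -> cycle_sum b s = C.

(** The remaining nodes of [D] complete both orders to Hamiltonian cycles, which differ only in the
    three arcs between [a] and [f]. *)
Let transpose_mid a x y f : uniq [:: a; x; y; f] ->
    {subset [:: a; x; y; f] <= D} -> uniq D ->
  b a x + b x y + b y f = b a y + b y x + b x f.
Proof.
move=> U4 s4D UD; pose r := [seq z <- D | z \notin [:: a; x; y; f]].
have Ur : uniq ([:: a; x; y; f] ++ r).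
  rewrite cat_uniq U4 filter_uniq // andbT /=.
  by apply/hasPn => z; rewrite mem_filter => /andP[].
have Dr : perm_eq ([:: a; x; y; f] ++ r) D.
  apply: uniq_perm => // z; rewrite mem_cat mem_filter.
  by case: (boolP (z \in [:: a; x; y; f])) => [/s4D->|].
have Pr : perm_eq ([:: a; x; y; f] ++ r) ([:: a; y; x; f] ++ r).
  by rewrite perm_cat2r perm_cons (perm_catCA [:: x] [:: y] [:: f]).
have Ur' : uniq ([:: a; y; x; f] ++ r) by rewrite -(perm_uniq Pr).
have := sumC Ur' (perm_trans (etrans (perm_sym _ _) Pr) Dr).
have := sumC Ur Dr.
rewrite /= !cycle_sum_cons //= => <-.
rewrite !addrA => /addIr ->; done.
Qed.

(* The difference of the two sides is half the sum of three transpositions of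
   neighbours on Hamiltonian cycles, hence already available on four nodes. *)
Lemma hamiltonian_exchange a x y f : uniq D -> uniq [:: a; x; y; f] ->
    {subset [:: a; x; y; f] <= D} ->
  b a x + b y f = b a f + b y x.
Proof.
move=> UD U4 s4D.
have E1 := transpose_mid U4 s4D UD.
have P2 : perm_eq [:: a; x; f; y] [:: a; x; y; f].
  by rewrite !perm_cons (perm_catC [:: f] [:: y]).
have P3 : perm_eq [:: a; y; f; x] [:: a; x; y; f].
  by rewrite perm_cons (perm_catC [:: y; f] [:: x]).
have E2 : b a x + b x f + b f y = b a f + b f x + b x y.
  apply: transpose_mid => //; first by rewrite (perm_uniq P2).
  by move=> z; rewrite (perm_mem P2); apply: s4D.
have E3 : b a y + b y f + b f x = b a f + b f y + b y x.
  apply: transpose_mid => //; first by rewrite (perm_uniq P3).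
  by move=> z; rewrite (perm_mem P3); apply: s4D.
lra.
Qed.

End HamiltonianExchange.

(** * Extending affinely independent families by one point *)

Section AffineIndependence.
Variables (R : realFieldType) (V : lmodType R).

Definition extend_family k (v : 'I_k -> V) (y : V) (i : 'I_k.+1) : V :=
  oapp v y (unlift ord0 i).

Lemma extend_family0 k (v : 'I_k -> V) y : extend_family v y ord0 = y.
Proof. by rewrite /extend_family unlift_none. Qed.

Lemma extend_familyS k (v : 'I_k -> V) y i :
  extend_family v y (lift ord0 i) = v i.
Proof. by rewrite /extend_family liftK. Qed.

Lemma extend_family_forall (P : V -> Prop) k (v : 'I_k -> V) y :
  (forall i, P (v i)) -> P y -> forall i, P (extend_family v y i).
Proof. by move=> Pv Py i; rewrite /extend_family; case: unliftP => /=. Qed.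

(** Applied to an affine dependence, [f - r] kills every [v i] and leaves a nonzero multiple of the
    coefficient of [y], which must be 0. *)
Lemma extend_affinely_independent (f : {scalar V}) (r : R) k (v : 'I_k -> V) y :
    affinely_independent v -> (forall i, f (v i) = r) -> f y != r ->
  affinely_independent (extend_family v y).
Proof.
move=> indep_v fv fy l; rewrite !big_ord_recl extend_family0.
under [X in _ -> _ + X = 0 -> _]eq_bigr do rewrite extend_familyS.
move=> suml sumv.
have /eqP : l ord0 * (f y - r) = 0.
  have := congr1 f sumv; rewrite linearD linearZ linear_sum linear0 /=.
  under eq_bigr do rewrite linearZ /= fv.
  have -> : \sum_(i < k) l (lift ord0 i) * r = (- l ord0) * r.
    by rewrite -mulr_suml -(addr0_eq suml).
  by rewrite mulrBr mulNr.
rewrite mulf_eq0 subr_eq0 (negPf fy) orbF => /eqP l0.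
move: suml sumv; rewrite l0 scale0r !add0r => suml sumv i.
case: (unliftP ord0 i) => [j ->|-> //].
exact: (indep_v (fun j => l (lift ord0 j))).
Qed.

End AffineIndependence.

(** * Linear spans and separating functionals *)

Section FreeFamilies.
Variables (R : realFieldType) (V : vectType R).

Lemma free_subseq_span (X : seq V) : exists B : seq V,
  [/\ {subset B <= X}, free B & {subset X <= <<B>>%VS}].
Proof.
elim: X => [|x X [B [sBX freeB sXB]]]; first by exists [::]; rewrite nil_free.
have [Bx | B'x] := boolP (x \in <<B>>%VS).
  exists B; split=> // y; first by move/sBX; rewrite inE orbC => ->.
  by rewrite inE => /predU1P[-> | /sXB].
exists (x :: B); split; last first.
- move=> y; rewrite inE => /predU1P[->|]; first by rewrite memv_span ?mem_head.
  move/sXB; apply/subvP; rewrite span_cons; exact: addvSr.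
- by rewrite free_cons B'x.
by move=> y; rewrite !inE => /predU1P[->|/sBX->]; rewrite ?eqxx ?orbT.
Qed.

Lemma free_affinely_independent (B : seq V) : free B ->
  affinely_independent (fun i : 'I_(size B) => B`_i).
Proof.
by move=> freeB l _; have /freeP := freeB : free (in_tuple B); apply.
Qed.

(** The points lie on the hyperplane [f = 1], which misses the origin: applying [f] to a linear
    relation shows that its coefficients sum to 0, so affine independence is linear independence
    here. *)
Lemma affinely_independent_leq_span (f : {scalar V}) k (v : 'I_k -> V)
    (X : seq V) : affinely_independent v -> (forall i, f (v i) = 1) ->
  (forall i, v i \in <<X>>%VS) -> (k <= size X)%N.
Proof.
move=> indep_v fv Xv; pose t := [tuple v i | i < k].
have tE (i : 'I_k) : t`_i = v i by rewrite -tnth_nth tnth_mktuple.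
have freet : free t.
  apply/freeP => l; under eq_bigr do rewrite tE; move=> suml.
  apply: indep_v => //; have := congr1 f suml.
  rewrite linear_sum linear0; under eq_bigr do rewrite linearZ /= fv mulr1.
  by [].
rewrite -(size_tuple t) -(eqP freet) (leq_trans _ (dim_span X)) //.
apply/dimvS/span_subvP => _ /tnthP[i ->]; by rewrite tnth_mktuple.
Qed.

End FreeFamilies.

(** The map [g = 1 - projv U] vanishes on [U] but not at [x], so some coordinate of [g] separates;
    [beta] lists its values on the unit vectors. *)
Lemma ffun_separation (R : realFieldType) (I : finType)
    (U : {vspace {ffun I -> R^o}}) (x : {ffun I -> R^o}) : x \notin U ->
  exists beta : I -> R, (forall v, v \in U -> \sum_a beta a * v a = 0) /\
    \sum_a beta a * x a != 0.
Proof.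
move=> U'x; pose g := (\1 - projv U)%VF.
have gE v : g v = v - projv U v by rewrite /g !lfunE /= !lfunE /=.
have [a gxa] : exists a, g x a != 0.
  apply/existsP; apply: contraR U'x => /existsPn gx0.
  suff -> : x = projv U x by apply: memv_proj.
  apply/eqP; rewrite -subr_eq0 -gE; apply/eqP/ffunP => a.
  by rewrite ffunE; apply/eqP; rewrite -[_ == _]negbK gx0.
pose e a' : {ffun I -> R^o} := [ffun a'' => (a'' == a')%:R].
have sumE (v : {ffun I -> R^o}) : \sum_a' g (e a') a * v a' = g v a.
  have {2}-> : v = \sum_a' v a' *: e a'.
    apply/ffunP => a''; rewrite sum_ffunE (bigD1 a'') //= !ffunE eqxx.
    rewrite [_ *: _]mulr1 big1 ?addr0 // => a' ne; rewrite !ffunE.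
    by rewrite eq_sym (negPf ne) [_ *: _]mulr0.
  rewrite linear_sum sum_ffunE; apply: eq_bigr => a' _.
  by rewrite linearZ ffunE mulrC.
exists (fun a' => g (e a') a); split=> [v Uv|]; rewrite sumE //.
by rewrite gE projv_id // subrr ffunE.
Qed.

(** * Linear functionals on a convex hull *)

Section ConvexHull.
Variables (R : realFieldType) (V : lmodType R) (P : V -> Prop).
Implicit Types (f g : {scalar V}) (r : R).

Lemma mem_convex_hull v : P v -> convex_hull P v.
Proof.
move=> Pv; exists 1%N, (fun=> v), (fun=> 1).
by split; rewrite ?big_ord1 ?scale1r.
Qed.

Lemma convex_hull_le f r x :
  (forall v, P v -> f v <= r) -> convex_hull P x -> f x <= r.
Proof.
move=> fP [k [v [l [Pv l_ge0 suml ->]]]]; rewrite linear_sum.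
rewrite -[r]mul1r -suml mulr_suml; apply: ler_sum => i _.
by rewrite linearZ ler_wpM2l ?fP.
Qed.

(** The slacks [l i * (r - f (v i))] are nonnegative and sum to 0, so every point of positive weight
    is tight for [f]. *)
Lemma convex_hull_face f g r r' x :
    (forall v, P v -> f v <= r) -> (forall v, P v -> f v = r -> g v = r') ->
  convex_hull P x -> f x = r -> g x = r'.
Proof.
move=> fP gP [k [v [l [Pv l_ge0 suml ->]]]]; rewrite !linear_sum => fx.
have slack0 : \sum_i l i * (r - f (v i)) = 0.
  under eq_bigr do rewrite mulrBr.
  rewrite sumrB -mulr_suml suml mul1r -{1}fx; apply/eqP.
  by rewrite subr_eq0; apply/eqP/eq_bigr => i _; rewrite linearZ.
rewrite -[r']mul1r -suml mulr_suml; apply: eq_bigr => i _; rewrite linearZ /=.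
have /eqP : l i * (r - f (v i)) = 0.
  by apply: (psumr_eq0P _ slack0) => // j _; rewrite mulr_ge0 ?subr_ge0 ?fP.
rewrite mulf_eq0 subr_eq0 => /predU1P[-> | /eqP fvi]; first by rewrite !mul0r.
by rewrite (gP (v i)).
Qed.

Lemma convex_hull_eq g r x :
  (forall v, P v -> g v = r) -> convex_hull P x -> g x = r.
Proof.
by move=> gP [k [v [l [Pv _ suml ->]]]]; rewrite linear_sum -[r]mul1r -suml mulr_suml;
  apply: eq_bigr => i _; rewrite linearZ /= gP.
Qed.

End ConvexHull.

(** * Arc weights as linear functionals on incidence vectors *)

Section ArcFunctionals.
Variables (R : realFieldType) (n : nat).
Notation arcvec := {ffun darc n -> R^o}.
Implicit Types (b : 'I_n -> 'I_n -> R) (s : seq 'I_n) (x : arcvec).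

(** Weights are given on ordered pairs of nodes, as for [cycle_sum]; their diagonal values do not
    enter. *)
Definition arc_functional b x : R :=
  \sum_a b (arc_tail a) (arc_head a) * x a.

Lemma arc_functional_is_scalar b : scalar (arc_functional b).
Proof.
move=> l x y; rewrite /arc_functional mulr_sumr -big_split /=.
by apply: eq_bigr => a _; rewrite !ffunE mulrDr; congr (_ + _); exact: mulrCA.
Qed.

HB.instance Definition _ b :=
  GRing.isLinear.Build R arcvec R *%R (arc_functional b)
    (arc_functional_is_scalar b).

Lemma eq_arc_functional b b' x : (forall i j, i != j -> b i j = b' i j) ->
  arc_functional b x = arc_functional b' x.
Proof. by move=> eqb; apply: eq_bigr => a _; rewrite eqb //; case: a. Qed.

Lemma arc_sum_from_to S S' x : arc_sum x (arcs_from_to S S') =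
  arc_functional (fun i j => ((i \in S) && (j \in S'))%:R) x.
Proof.
rewrite /arc_sum big_mkcond; apply: eq_bigr => a _; rewrite inE.
by case: ifP => _; rewrite ?mul1r ?mul0r.
Qed.

Lemma arc_sum_delta_out i x : arc_sum x (delta_out i) =
  arc_functional (fun j _ => (j == i)%:R) x.
Proof.
rewrite /arc_sum big_mkcond; apply: eq_bigr => a _; rewrite inE.
by case: ifP => _; rewrite ?mul1r ?mul0r.
Qed.

Definition cycle_arcs s : {set darc n} :=
  [set a | (arc_tail a \in s) && (arc_head a == next s (arc_tail a))].

Lemma simple_dicycleP (F : {set darc n}) :
  simple_dicycle F <-> exists s, [/\ uniq s, (1 < size s)%N & F = cycle_arcs s].
Proof.
split=> [[s [s_neq0 /andP[cs Us] ->]] | [s [Us szs ->]]]; exists s; split=> //.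
- by case: s s_neq0 cs {Us} => [|x [|y s]] //; rewrite /adj /= eqxx.
- by case: s szs {Us}.
apply/andP; split=> //; apply: cycle_from_next => // i si.
by rewrite /adj /= eq_sym next_neq.
Qed.

Lemma arc_functional_incidence b s : uniq s -> (1 < size s)%N ->
  arc_functional b (incidence R (cycle_arcs s)) = cycle_sum b s.
Proof.
move=> Us szs; pose G (u : 'I_n * 'I_n) : R :=
  b u.1 u.2 * ((u.1 \in s) && (u.2 == next s u.1))%:R.
transitivity (\sum_(a : darc n) G (val a)).
  by apply: eq_bigr => a _; rewrite ffunE inE.
(* The sum over arcs becomes a double sum over tails and heads, where a tail [i] in [s] keeps only
   the head [next s i]. *)
rewrite -(big_sub (fun u : 'I_n * 'I_n => adj u.1 u.2) G).
rewrite /cycle_sum big_uniq //=.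
rewrite -(pair_big_dep predT (fun i j => adj i j) (fun i j => G (i, j))) /=.
rewrite [RHS]big_mkcond; apply: eq_bigr => i _; case: ifP => si.
  rewrite (bigD1 (next s i)) /=; last by rewrite /adj /= eq_sym next_neq.
  rewrite /G /= si eqxx mulr1 big1 ?addr0 // => j /andP[_ /negPf->].
  by rewrite andbF mulr0.
by rewrite big1 // => j _; rewrite /G /= si mulr0.
Qed.

(** The constant weight 1 counts arcs on one side and nodes on the other; the comparison takes place
    in [R]. *)
Lemma card_cycle_arcs s : uniq s -> (1 < size s)%N -> #|cycle_arcs s| = size s.
Proof.
move=> Us szs; apply/eqP; rewrite -(eqr_nat R).
have := arc_functional_incidence (fun _ _ => 1) Us szs.
rewrite /cycle_sum big_const_seq count_predT iter_addr_0 => <-.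
rewrite /arc_functional -sum1_card natr_sum big_mkcond /=.
by apply/eqP/eq_bigr => a _; rewrite ffunE mul1r; case: ifP.
Qed.

Lemma delta_out_cycle i s : uniq s -> (1 < size s)%N -> i \in s ->
  arc_sum (incidence R (cycle_arcs s)) (delta_out i) = 1.
Proof.
move=> Us szs si; rewrite arc_sum_delta_out arc_functional_incidence //.
rewrite /cycle_sum (bigD1_seq i) //= eqxx big1 ?addr0 // => j /negPf-> //.
Qed.

Lemma cycle_polytope_cycle c s : uniq s -> (1 < size s)%N -> size s \in c ->
  cycle_polytope c (incidence R (cycle_arcs s)).
Proof.
move=> Us szs cs; apply: mem_convex_hull; exists (cycle_arcs s).
by split; rewrite ?card_cycle_arcs //; apply/simple_dicycleP; exists s.
Qed.

Lemma cycle_polytope_potential c (phi : 'I_n -> R) x :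
  cycle_polytope c x -> arc_functional (fun i j => phi i - phi j) x = 0.
Proof.
apply: convex_hull_eq => _ [F [/simple_dicycleP[s [Us szs ->]] _ ->]].
by rewrite /= arc_functional_incidence ?cycle_sum_potential.
Qed.

End ArcFunctionals.

(** * Choosing sequences of distinct elements *)

Lemma uniq_seq_of_card (T : finType) (A : {set T}) m : (m <= #|A|)%N ->
  exists s, [/\ uniq s, size s = m & {subset s <= A}].
Proof.
move=> lemA; exists (take m (enum A)); split; first by rewrite take_uniq ?enum_uniq.
  by rewrite size_takel // -cardE.
by move=> x /mem_take; rewrite mem_enum.
Qed.

Lemma uniq_seq_extend (T : finType) (A : {set T}) l m :
    uniq l -> {subset l <= A} -> (m + size l <= #|A|)%N ->
  exists s, [/\ uniq (l ++ s), size s = m & {subset l ++ s <= A}].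
Proof.
move=> Ul lA le_mA; have cl : #|[set x in l]| = size l.
  by rewrite cardsE; apply/card_uniqP.
have [|s [Us szs sA]] := @uniq_seq_of_card _ (A :\: [set x in l]) m.
  rewrite cardsD (setIidPr _) ?cl; last by apply/subsetP => x; rewrite in_set => /lA.
  by rewrite leq_subRL ?(leq_trans (leq_addl _ _) le_mA) // addnC.
exists s; split=> // [|x]; last first.
  by rewrite mem_cat => /orP[/lA // | /sA]; rewrite in_setD => /andP[].
rewrite cat_uniq Ul Us andbT; apply/hasPn => x /sA.
by rewrite in_setD in_set => /andP[].
Qed.

(** * The inequality evaluated on cycles *)

Section SubgraphInequality.
Variables (R : realFieldType) (n : nat) (W : {set 'I_n}) (k : nat).
Implicit Types (s p q : seq 'I_n) (x y : 'I_n).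

Definition exit_coef (i j : 'I_n) : R := ((i \in W) && (j \notin W))%:R.

Definition subgraph_coef (i j : 'I_n) : R :=
  2 * ((i \in W) && (j \in W))%:R -
  (#|W|%:R - k%:R - 1) * (exit_coef i j + ((i \notin W) && (j \in W))%:R).

Lemma cardsubgraph_lhsE (v : {ffun darc n -> R^o}) :
  cardsubgraph_lhs W k v = arc_functional subgraph_coef v.
Proof.
rewrite /cardsubgraph_lhs /arcs_inside !arc_sum_from_to /arc_functional.
rewrite -big_split !mulr_sumr -sumrB; apply: eq_bigr => a _ /=.
by rewrite /subgraph_coef /exit_coef !inE; ring.
Qed.

Definition exits s := count (fun i => (i \in W) && (next s i \notin W)) s.

Lemma cycle_sum_exit s : cycle_sum exit_coef s = (exits s)%:R.
Proof.
by rewrite /cycle_sum /exit_coef -natr_sum /exits -sum1_count [in RHS]big_mkcond.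
Qed.

(** A cycle enters [W] as often as it leaves it, so up to a potential the weight sits on the tails
    in [W] and on the leaving arcs only. *)
Lemma subgraph_coef_potential i j : let D : R := #|W|%:R - k%:R in
  subgraph_coef i j = 2 * (i \in W)%:R - 2 * D * exit_coef i j +
    (((D - 1) * (i \in W)%:R) - (D - 1) * (j \in W)%:R).
Proof.
rewrite /subgraph_coef /exit_coef /=.
by case: (i \in W); case: (j \in W) => /=; ring.
Qed.

Lemma cycle_sum_subgraph s : uniq s -> cycle_sum subgraph_coef s =
  2 * ((count (mem W) s)%:R - (#|W|%:R - k%:R) * (exits s)%:R).
Proof.
move=> Us; rewrite -cycle_sum_exit /cycle_sum.
under eq_bigr do rewrite subgraph_coef_potential.
rewrite big_split /= [X in _ + X](cycle_sum_potential _ Us) addr0 sumrB.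
rewrite -!mulr_sumr.
have -> : \sum_(i <- s) (i \in W)%:R = (count (mem W) s)%:R :> R.
  by rewrite -natr_sum -sum1_count [in RHS]big_mkcond.
by ring.
Qed.

Lemma count_mem_le s : uniq s -> (count (mem W) s <= #|W|)%N.
Proof.
move=> Us; rewrite -size_filter cardE uniq_leq_size ?filter_uniq // => i.
by rewrite mem_filter mem_enum => /andP[].
Qed.

(** Without an exit, membership in [W] propagates from each node to the next, hence around the whole
    cycle. *)
Lemma exits_eq0 s : uniq s -> exits s = 0%N ->
  count (mem W) s = 0%N \/ count (mem W) s = size s.
Proof.
move=> Us /eqP; rewrite eqn0Ngt -has_count -all_predC => /allP no_exit.
have [/hasP[i si Wi] | ] := boolP (has (mem W) s); last first.
  by rewrite has_count -eqn0Ngt => /eqP; left.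
right; apply/eqP; rewrite -all_count; pose e := [rel x y | (x \in W) ==> (y \in W)].
have : cycle e s.
  apply: cycle_from_next => // j sj; have := no_exit j sj.
  by rewrite /= negb_and negbK implybE.
have [m s' def_s] := rot_to si.
rewrite -(rot_cycle m) -(eq_all_r (mem_rot m s)) def_s /= => e_s'; move: e_s' Wi.
rewrite rcons_path => /andP[e_s' _] Wi; rewrite [i \in W]Wi /=.
elim: s' i e_s' Wi {si def_s} => //= j s' IH i /andP[/implyP eij e_s'] /eij Wj.
by rewrite Wj (IH j).
Qed.

(** With an exit, the count is at most [#|W|] and each further exit has the favourable sign. Without
    one, the cycle misses [W] or lies inside it, and then the gap in the lengths gives size at most
    [k]. *)
Lemma exits_bound s : uniq s -> (k < #|W|)%N ->
    (size s <= k)%N || (#|W| < size s)%N ->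
  (count (mem W) s + k * exits s <= k + #|W| * exits s)%N.
Proof.
move=> Us lt_kW szs; have := count_mem_le Us.
case def_t: (exits s) => [|t]; last by nia.
have [->|def_a] := exits_eq0 Us def_t; first by nia.
by rewrite def_a; lia.
Qed.

Lemma cycle_sum_subgraph_le s : uniq s -> (k < #|W|)%N ->
    (size s <= k)%N || (#|W| < size s)%N ->
  cycle_sum subgraph_coef s <= 2 * k%:R.
Proof.
move=> Us lt_kW szs; rewrite cycle_sum_subgraph //.
by have := exits_bound Us lt_kW szs; rewrite -(ler_nat R) !natrD !natrM; lra.
Qed.

(** Two or more exits would make the bound strict. One exit forces the cycle to cover [W], hence a
    length above [k]; no exit forces length [k], as [0 < k] rules out cycles that miss [W]. *)
Lemma cycle_sum_subgraph_eq s : uniq s -> (0 < k < #|W|)%N ->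
    (size s <= k)%N || (#|W| < size s)%N ->
    cycle_sum subgraph_coef s = 2 * k%:R ->
  (size s = k /\ exits s = 0%N) \/ ((#|W| < size s)%N /\ exits s = 1%N).
Proof.
move=> Us /andP[k_gt0 lt_kW] szs; rewrite cycle_sum_subgraph // => tight.
have : (count (mem W) s + k * exits s = k + #|W| * exits s)%N.
  by apply/eqP; rewrite -(eqr_nat R) !natrD !natrM; apply/eqP; lra.
have := count_mem_le Us; have := count_size (mem W) s.
case def_t: (exits s) => [|[|t]] les leW eqa; last by nia.
  have [a0|def_a] := exits_eq0 Us def_t; first by move: eqa; rewrite a0; lia.
  by left; move: eqa; rewrite def_a; lia.
right; split=> //; move: szs eqa; rewrite !muln1 addnC => szs /addnI eqa.
move: les; rewrite eqa; case/orP: szs => // lesk lesW.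
by have := leq_trans lt_kW (leq_trans lesW lesk); rewrite ltnn.
Qed.

Lemma exits_eq1 x p y q : uniq ((x :: p) ++ y :: q) ->
  {subset x :: p <= W} -> {subset y :: q <= ~: W} ->
  exits ((x :: p) ++ y :: q) = 1%N.
Proof.
move=> Us sW sZ; apply/eqP; rewrite -(eqr_nat R) -cycle_sum_exit.
have := Us; rewrite cat_uniq => /and3P[Uxp _ Uyq].
rewrite cycle_sum_cat // (path_sum_head (tau := fun=> 0) Uxp); last first.
  by move=> i j _ /sW Wj _; rewrite /exit_coef Wj andbF.
rewrite (path_sum_head (tau := fun=> 0) Uyq); last first.
  by move=> i j /sZ; rewrite in_setC => /negPf Wi _ _; rewrite /exit_coef Wi.
have Wl := sW _ (mem_last x p); have := sZ _ (mem_last y q).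
have := sZ _ (mem_head y q); rewrite !in_setC /exit_coef Wl => -> /negPf->.
by rewrite !big1 //= !add0r !addr0.
Qed.

Lemma cycle_sum_subgraph_cat x p y q : uniq ((x :: p) ++ y :: q) ->
  {subset x :: p <= W} -> {subset y :: q <= ~: W} ->
  cycle_sum subgraph_coef ((x :: p) ++ y :: q) =
    2 * ((size p).+1%:R - #|W|%:R + k%:R).
Proof.
move=> Us sW sZ; rewrite cycle_sum_subgraph // exits_eq1 // mulr1 opprB addrA.
congr (2 * _); rewrite count_cat.
have -> : count (mem W) (x :: p) = (size p).+1.
  by apply/eqP; rewrite -[_.+1]/(size (x :: p)) -all_count; apply/allP.
have -> : count (mem W) (y :: q) = 0%N; last by rewrite addn0 addrAC.
apply/eqP; rewrite eqn0Ngt -has_count; apply/hasPn => i /sZ.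
by rewrite in_setC.
Qed.

Lemma cycle_sum_subgraph_inside s : uniq s -> {subset s <= W} ->
  cycle_sum subgraph_coef s = 2 * (size s)%:R.
Proof.
move=> Us sW; rewrite cycle_sum_subgraph //.
have -> : exits s = 0%N.
  apply/eqP; rewrite eqn0Ngt -has_count; apply/hasPn => i si /=.
  by rewrite negb_and negbK (sW (next s i)) ?mem_next // orbT.
rewrite mulr0 subr0; suff -> : count (mem W) s = size s by [].
by apply/eqP; rewrite -all_count; apply/allP.
Qed.

End SubgraphInequality.

(** * Functionals vanishing on the cycles that traverse [W] and then a path outside *)

Section OuterCycles.
Variables (R : realFieldType) (n : nat) (W : {set 'I_n}) (b : 'I_n -> 'I_n -> R).
Implicit Types (i j x y z : 'I_n) (s p q u : seq 'I_n).

(** For [e > 0] with [#|W| + e] an admissible length, these are the tight cycles of the second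
    kind. *)
Definition outer_zero e := forall u q, uniq u -> {subset u <= W} ->
  size u = #|W| -> uniq q -> {subset q <= ~: W} -> size q = e ->
  cycle_sum b (u ++ q) = 0.

(* The node [None] stands for a path of nodes outside [W], from [z] to [y],
   that has been contracted. *)
Definition contracted z y (a a' : option 'I_n) : R :=
  match a, a' with
  | Some i, Some j => b i j
  | Some i, None => b i z
  | None, Some j => b y j
  | None, None => 0
  end.

Lemma cat_uniq_setC u q : uniq u -> uniq q -> {subset u <= W} ->
  {subset q <= ~: W} -> uniq (u ++ q).
Proof.
move=> Uu Uq uW qZ; rewrite cat_uniq Uu Uq andbT; apply/hasPn => i /qZ.
by rewrite in_setC; apply: contra => /uW.
Qed.

(** Rotated to start at [None], the cycle expands to one through all of [W] and [z :: q], of sum 0;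
    contraction drops exactly the arcs of the path. *)
Lemma contracted_hamiltonian z q (s : seq (option _)) : W != set0 -> outer_zero (size (z :: q)) ->
    uniq (z :: q) -> {subset z :: q <= ~: W} ->
    uniq s -> perm_eq s (None :: map Some (enum W)) ->
  cycle_sum (contracted z (last z q)) s = - path_sum b z q.
Proof.
move=> W_neq0 outer0 Uq qZ Us sD.
have sN : None \in s by rewrite (perm_mem sD) mem_head.
have [m s' def_s] := rot_to sN.
rewrite -(cycle_sum_rot _ m Us) def_s.
have Us' : uniq (None :: s') by rewrite -def_s rot_uniq.
have s'D : perm_eq s' (map Some (enum W)).
  by rewrite -(perm_cons None) -def_s perm_rot.
pose u := pmap id s'.
have def_s' : s' = map Some u.
  have : all isSome s'.
    by rewrite (perm_all _ s'D) all_map; apply/allP.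
  by rewrite /u; elim: (s') => [|[i|] s2 IH] //= /IH {1}->.
have uW : perm_eq u (enum W).
  by apply: (perm_map_inj (f := Some)) => [i j []|] //; rewrite -def_s'.
have Uu : uniq u by rewrite (perm_uniq uW) enum_uniq.
have suW : {subset u <= W} by move=> i; rewrite (perm_mem uW) mem_enum.
have szu : size u = #|W| by rewrite (perm_size uW) -cardE.
have := outer0 u (z :: q) Uu suW szu Uq qZ erefl.
have Uuq := cat_uniq_setC Uu Uq suW qZ.
rewrite cycle_sum_cons // def_s'.
case: u Uuq szu {def_s' uW Uu suW} => [|x p] Uuq szu.
  by move: W_neq0; rewrite -card_gt0 -szu.
rewrite cycle_sum_cat //= path_sum_rcons.
have -> : path_sum (contracted z (last z q)) (Some x) (map Some p) =
          path_sum b x p.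
  by elim: p x {Uuq szu} => //= y p IH x; rewrite IH.
by rewrite last_map /=; lra.
Qed.

Lemma contracted_exchange z q (a x y f : option _) : W != set0 -> outer_zero (size (z :: q)) ->
    uniq (z :: q) -> {subset z :: q <= ~: W} ->
    uniq [:: a; x; y; f] -> {subset [:: a; x; y; f] <= None :: map Some (enum W)} ->
  let B := contracted z (last z q) in B a x + B y f = B a f + B y x.
Proof.
move=> W_neq0 outer0 Uq qZ U4 s4.
apply: (@hamiltonian_exchange _ _ _ (None :: map Some (enum W))) U4 s4.
  by move=> s Us sD; apply: contracted_hamiltonian Us sD.
rewrite /= map_inj_uniq ?enum_uniq ?andbT; last by move=> ? ? [].
by apply/mapP => [[]].
Qed.

(** At most one of the four nodes is outside [W], and it becomes the contracted path. Since [a] and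
    [y] occur only as tails, the path has to end there; since [x] and [f] occur only as heads, it
    has to start there. *)
Lemma outer_exchange e a x y f : (0 < e <= #|~: W|)%N -> outer_zero e ->
    uniq [:: a; x; y; f] -> (2 < count (mem W) [:: a; x; y; f])%N ->
  b a x + b y f = b a f + b y x.
Proof.
move=> /andP[e_gt0 le_eZ] outer0 U4 cW.
have W_neq0 : W != set0.
  by apply: contraTneq cW => ->; rewrite /= !inE.
have through o : o \notin W -> exists q, [/\ uniq (o :: q),
    {subset o :: q <= ~: W} & size (o :: q) = e].
  move=> Zo; have [|||q [Uq szq qZ]] := @uniq_seq_extend _ (~: W) [:: o] e.-1.
  - by [].
  - by move=> i; rewrite inE => /eqP->; rewrite in_setC.
  - by rewrite addn1 prednK.
  by exists q; split=> //; rewrite /= szq prednK.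
have into o : o \notin W -> exists z q, [/\ last z q = o, uniq (z :: q),
    {subset z :: q <= ~: W} & size (z :: q) = e].
  move=> /through[q [Uq qZ szq]]; have := last_rcons o q o.
  have := rcons_uniq q o; have := mem_rcons q o; have := size_rcons q o.
  case: (rcons q o) => // z q' szq' mq Uq' lq; exists z, q'.
  by split=> //; rewrite ?Uq' ?szq' // => i; rewrite mq; apply: qZ.
have sub4 (t : seq (option 'I_n)) : all (fun o => if o is Some i then i \in W else true) t ->
    {subset t <= None :: map Some (enum W)}.
  move=> /allP tW [i|] /tW; rewrite inE //= mem_map ?mem_enum //.
  by move=> ? ? [].
have xch z q (a' x' y' f' : option _) := @contracted_exchange z q a' x' y' f' W_neq0.
have optE : ((forall i j, (Some i == Some j) = (i == j)) *
    ((forall i, (Some i == None) = false) * (forall i, (None == Some i) = false)))%type.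
  by [].
move: cW; rewrite /= addn0.
have [Wa|Za] := boolP (a \in W); last first.
  move=> cW; have [Wx Wy Wf] : [/\ x \in W, y \in W & f \in W].
    by move: cW; do 3![case: (_ \in W)].
  have [z [q [<- Uq qZ szq]]] := into a Za; rewrite -szq in outer0.
  refine (xch z q None (Some x) (Some y) (Some f) outer0 Uq qZ _ _) => //.
  - by move: U4; rewrite /= !inE !optE; do 6?[case: (_ == _)].
  - by apply: sub4; rewrite /= Wx Wy Wf.
have [Wx|Zx] := boolP (x \in W); last first.
  move=> cW; have [Wy Wf] : y \in W /\ f \in W.
    by move: cW; do 2![case: (_ \in W)].
  have [q [Uq qZ szq]] := through x Zx; rewrite -szq in outer0.
  refine (xch x q (Some a) None (Some y) (Some f) outer0 Uq qZ _ _) => //.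
  - by move: U4; rewrite /= !inE !optE; do 6?[case: (_ == _)].
  - by apply: sub4; rewrite /= Wa Wy Wf.
have [Wy|Zy] := boolP (y \in W); last first.
  move=> cW; have Wf : f \in W by move: cW; case: (_ \in W).
  have [z [q [<- Uq qZ szq]]] := into y Zy; rewrite -szq in outer0.
  refine (xch z q (Some a) (Some x) None (Some f) outer0 Uq qZ _ _) => //.
  - by move: U4; rewrite /= !inE !optE; do 6?[case: (_ == _)].
  - by apply: sub4; rewrite /= Wa Wx Wf.
have [Wf _|Zf _] := boolP (f \in W); last first.
  have [q [Uq qZ szq]] := through f Zf; rewrite -szq in outer0.
  refine (xch f q (Some a) (Some x) (Some y) None outer0 Uq qZ _ _) => //.
  - by move: U4; rewrite /= !inE !optE; do 6?[case: (_ == _)].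
  - by apply: sub4; rewrite /= Wa Wx Wy.
have [o Zo] : exists o, o \notin W.
  have /card_gt0P[o] : (0 < #|~: W|)%N by lia.
  by rewrite in_setC => Zo; exists o.
have [q [Uq qZ szq]] := through o Zo; rewrite -szq in outer0.
refine (xch o q (Some a) (Some x) (Some y) (Some f) outer0 Uq qZ _ _) => //.
by apply: sub4; rewrite /= Wa Wx Wy Wf.
Qed.

Lemma outer_separable e : (0 < e <= #|~: W|)%N -> (2 < #|W|)%N -> outer_zero e ->
  exists phi psi : 'I_n -> R, forall i j, i != j -> (i \in W) || (j \in W) ->
    b i j = phi i + psi j.
Proof.
move=> eZ W_gt2 outer0.
have [[|r [|u [|v [|o l]]]] [] //] := uniq_seq_of_card W_gt2.
rewrite /= !inE !andbT => /andP[/norP[ru rv] uv] _ sW.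
have [Wr Wu Wv] : [/\ r \in W, u \in W & v \in W].
  by rewrite !sW // !inE eqxx ?orbT.
have [z Zz] : exists z, z \notin W.
  have /card_gt0P[z] : (0 < #|~: W|)%N by case/andP: eZ => *; lia.
  by rewrite in_setC => Zz; exists z.
have xch a x y f : [&& a != x, a != y, a != f, x != y, x != f & y != f] ->
    (2 < count (mem W) [:: a; x; y; f])%N -> b a x + b y f = b a f + b y x.
  move=> /and5P[ax ay af xy /andP[xf yf]]; apply: outer_exchange eZ outer0 _.
  by rewrite /= !inE !negb_or ax ay af xy xf yf.
(* Normalising [phi r = 0] forces [psi j = b r j]. The arcs into [u] then give [phi], the arc from
   [u] to [v] gives [phi u], and the arc from [u] to [r] gives [psi r]. *)
pose phi i := if i == r then 0 else
  if i == u then b u v - b r v else b i u - b r u.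
pose psi j := if j == r then b u r - b u v + b r v else b r j.
have vr : v != r by rewrite eq_sym. have vu : v != u by rewrite eq_sym.
have ur : u != r by rewrite eq_sym.
have into_r i : i != r -> i != u -> i != v ->
    b i r = b i u - b r u + (b u r - b u v + b r v).
  move=> ir iu iv.
  have E1 : b i r + b u v = b i v + b u r.
    by apply: xch; rewrite ?ir ?iu ?iv ?ru ?rv //= Wr Wu Wv; case: (i \in W).
  have E2 : b i v + b r u = b i u + b r v.
    by apply: xch; rewrite ?ir ?iu ?iv ?vr ?vu ?ru //= Wr Wu Wv; case: (i \in W).
  by lra.
exists phi, psi => i j ij WiWj; rewrite /phi /psi.
have [eqir | ir] := eqVneq i r.
  by rewrite add0r -eqir eq_sym (negPf ij) eqir.
have [eqiu | iu] := eqVneq i u.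
  have uj : u != j by rewrite -eqiu.
  rewrite eqiu; have [-> | jr] := eqVneq j r; first by lra.
  have [->|jv] := eqVneq j v; first by lra.
  have : b u j + b r v = b u v + b r j.
    by apply: xch; rewrite ?uj ?ur ?uv ?jr ?jv //= Wr Wu Wv; case: (j \in W).
  by lra.
have [-> | jr] := eqVneq j r.
  have [->|iv] := eqVneq i v; last exact: into_r.
  (* [W] may have only three nodes, so the fourth node for the pair [v], [r] is taken outside. *)
  have neqZ o : o \in W -> z != o by apply: contraTneq => <-.
  have := into_r z (neqZ _ Wr) (neqZ _ Wu) (neqZ _ Wv).
  have : b v r + b z u = b v u + b z r.
    apply: xch; last by rewrite /= Wr Wu Wv; case: (z \in W).
    by rewrite vr vu ru (eq_sym v z) (eq_sym r z) !neqZ.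
  by lra.
have [->|ju] := eqVneq j u; first by lra.
have : b i j + b r u = b i u + b r j.
  apply: xch; rewrite ?ij ?ir ?iu ?jr ?ju ?ru //= Wr Wu.
  by case: (i \in W) (j \in W) WiWj => [] [].
by lra.
Qed.

End OuterCycles.

(** * Normal form of functionals vanishing on the tight cycles *)

Section NormalForm.
Variables (R : realFieldType) (n : nat) (W : {set 'I_n}) (k : nat) (r : 'I_n).
Hypotheses (Wr : r \in W) (k_range : (1 < k < #|W|)%N).
Implicit Types (i j x y z : 'I_n) (s p q u : seq 'I_n) (b d : 'I_n -> 'I_n -> R).

Definition inner_zero b := forall s, uniq s -> r \in s -> {subset s <= W} ->
  size s = k -> cycle_sum b s = 0.

Lemma path_sum_eq0 d (Z : {set 'I_n}) m : (0 < m < #|Z|)%N ->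
    (forall x p, uniq (x :: p) -> {subset x :: p <= Z} -> size p = m ->
      path_sum d x p = 0) ->
  forall x y, x \in Z -> y \in Z -> x != y -> d x y = 0.
Proof.
move=> /andP[m_gt0 lt_mZ] path0 x y Zx Zy xy.
have szl2 : (m.-1 + 2 <= #|Z|)%N by lia.
have U2 : uniq [:: x; y] by rewrite /= inE xy.
have xyZ : {subset [:: x; y] <= Z} by move=> i; rewrite !inE => /orP[] /eqP->.
have [l [Us szl sZ]] := uniq_seq_extend U2 xyZ szl2.
pose s := x :: y :: l.
have szs : size s = m.+1 by rewrite /= szl prednK.
(* Deleting any arc of the cycle [s] leaves a path of sum 0, so every arc of [s]
   carries the whole sum of [s]. *)
have all_eq i : i \in s -> d i (next s i) = cycle_sum d s.
  move=> si; have [m' s' def_s] := rot_to si.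
  have Us' : uniq (i :: s') by rewrite -def_s rot_uniq.
  have szs' : size (i :: s') = m.+1 by rewrite -def_s size_rot.
  have s'Z : {subset i :: s' <= Z}.
    by move=> j; rewrite -def_s mem_rot; apply: sZ.
  rewrite -(cycle_sum_rot d m' Us) -(next_rot m' Us) def_s.
  case: s' Us' szs' s'Z {def_s} => [|j s'] Us' szs' s'Z.
    by case: szs' => m0; rewrite -m0 in m_gt0.
  rewrite cycle_sum_cons //= eqxx (path0 j (rcons s' i)) ?addr0 //.
  - by rewrite -rcons_cons rcons_uniq -cons_uniq.
  - by move=> o; rewrite -rcons_cons mem_rcons; apply: s'Z.
  by rewrite size_rcons; case: szs'.
(* Adding the [m + 1] equal arc weights gives [m + 1] times the cycle sum, which is again the cycle
   sum. *)
have /eqP : cycle_sum d s *+ m = 0.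
  have : cycle_sum d s = cycle_sum d s *+ m.+1.
    rewrite {1}/cycle_sum big_seq; under eq_bigr => i si do rewrite all_eq //.
    by rewrite -big_seq big_const_seq count_predT szs iter_addr_0.
  by rewrite mulrS => /eqP; rewrite -subr_eq0 opprD addrA subrr sub0r oppr_eq0 => /eqP.
rewrite mulrn_eq0 -leqn0 leqNgt m_gt0 /= => /eqP sum0.
by have := all_eq x; rewrite /= eqxx sum0 mem_head => ->.
Qed.

(** * Weights that depend only on the head for arcs meeting [W] *)

Section Gauged.
Variables (d : 'I_n -> 'I_n -> R) (tau : 'I_n -> R).
Hypothesis dE : forall i j, i != j -> (i \in W) || (j \in W) -> d i j = tau j.
Hypothesis inner0 : inner_zero d.

(** Cycles of length [k] through [r] that differ in one node show that [tau] is a constant [t] on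
    [W] minus [r]; any one of them then gives [tau r = - (k - 1) t]. *)
Lemma gauged_inner : exists t : R, forall j, j \in W ->
  tau j = t - (j == r)%:R * (k%:R * t).
Proof.
have sum0 l : uniq l -> {subset l <= W :\ r} -> size l = k.-1 ->
    tau r + \sum_(j <- l) tau j = 0.
  move=> Ul lW szl.
  have Us : uniq (r :: l).
    by rewrite /= Ul andbT; apply/negP => /lW; rewrite !inE eqxx.
  have sW : {subset r :: l <= W}.
    by move=> i; rewrite inE => /predU1P[-> //|/lW]; rewrite !inE => /andP[].
  have szs : size (r :: l) = k by rewrite /= szl; lia.
  have := inner0 Us (mem_head r l) sW szs.
  rewrite (cycle_sum_head (tau := tau) Us) ?big_cons //; first by rewrite szs; lia.
  by move=> i j si _ ij; rewrite dE // sW.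
have szW : (k.-1 + 1 <= #|W|)%N by lia.
have rW : {subset [:: r] <= W} by move=> i; rewrite inE => /eqP->.
have [[|u l] [Uul szul rulW]] := uniq_seq_extend (isT : uniq [:: r]) rW szW.
  by move: szul => /=; lia.
move: Uul; rewrite cat1s cons_uniq => /andP[rul Uul].
have ulW : {subset u :: l <= W :\ r}.
  move=> i iul; rewrite in_setD1 rulW ?mem_cat ?iul ?orbT // andbT.
  by apply: contraNneq rul => <-.
have tauE j : j \in W :\ r -> tau j = tau u.
  move=> Wj; have [->//|ju] := eqVneq j u.
  have Wu := ulW u (mem_head _ _).
  have szq3 : (k.-2 + 3 <= #|W|)%N by lia.
  move: Wj Wu; rewrite !in_setD1 => /andP[jr Wj] /andP[ur Wu].
  have U3 : uniq [:: r; u; j].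
    by rewrite /= !inE negb_or [r == u]eq_sym [r == j]eq_sym [u == j]eq_sym ur jr ju.
  have W3 : {subset [:: r; u; j] <= W} by move=> i; rewrite !inE => /or3P[] /eqP->.
  have [q [Uq szq qW]] := uniq_seq_extend U3 W3 szq3.
  move: Uq; rewrite /= !inE !negb_or.
  move=> /and4P[/and3P[_ _ rq] /andP[_ uq] jq Uq].
  have sumq o : (o == j) || (o == u) -> tau r + (tau o + \sum_(i <- q) tau i) = 0.
    move=> oju; have := sum0 (o :: q); rewrite big_cons; apply.
    - by rewrite /= Uq andbT; case/predU1P: oju => [->|/eqP->].
    - move=> i; rewrite inE in_setD1 => /predU1P[->|qi].
        by case/predU1P: oju => [->|/eqP->]; rewrite ?jr ?ur.
      by rewrite qW ?mem_cat ?qi ?orbT // andbT; apply: contraNneq rq => <-.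
    by rewrite /= szq; case: (k) k_range => [|[]].
  have := sumq j; have := sumq u; rewrite !eqxx orbT => /(_ isT) + /(_ isT).
  by lra.
exists (tau u) => j Wj; have [->|jr] := eqVneq j r; last first.
  by rewrite mul0r subr0 tauE // in_setD1 jr.
have := sum0 _ Uul ulW szul.
rewrite (eq_big_seq (fun=> tau u)); last by move=> i /ulW /tauE.
rewrite big_const_seq count_predT szul iter_addr_0 -mulr_natl.
have -> : k%:R = k.-1%:R + 1 :> R by rewrite natr1 prednK //; lia.
by rewrite mul1r; lra.
Qed.

Variable t : R.
Hypothesis tauE : forall j, j \in W -> tau j = t - (j == r)%:R * (k%:R * t).

(** In the cycle through [W] and [z :: q], the arcs meeting [W] contribute [tau] over [W] and
    [tau z]. Over [W], [tau] sums to [(#|W| - k) t]. *)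
Lemma gauged_outer e : (0 < e)%N -> outer_zero W d e ->
  forall z q, uniq (z :: q) -> {subset z :: q <= ~: W} -> size (z :: q) = e ->
  tau z + path_sum d z q = - ((#|W|%:R - k%:R) * t).
Proof.
move=> e_gt0 outer0 z q Uq qZ szq.
have sW : {subset enum W <= W} by move=> i; rewrite mem_enum.
have := outer0 _ _ (enum_uniq W) sW (esym (cardE W)) Uq qZ szq.
have Us := cat_uniq_setC (enum_uniq W) Uq sW qZ.
have sumW : \sum_(j <- enum W) tau j = (#|W|%:R - k%:R) * t.
  rewrite (eq_big_seq (fun j => t - (j == r)%:R * (k%:R * t))); last first.
    by move=> j /sW; apply: tauE.
  rewrite sumrB big_const_seq count_predT -cardE iter_addr_0 -mulr_suml.
  rewrite (bigD1_seq r) ?enum_uniq ?mem_enum //= eqxx big1 => [|j /negPf->] //.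
  by rewrite addr0 mul1r mulrBl !mulr_natl.
move: (enum_uniq W) sW Us sumW (mem_enum W r); rewrite Wr.
case: (enum W) => [|x p] // Ux sW Us sumW _.
rewrite cycle_sum_cat // (path_sum_head (tau := tau) Ux); last first.
  by move=> i j /sW Wi _ ij; rewrite dE ?Wi.
have Zz : z \notin W by rewrite -in_setC qZ ?mem_head.
have Zl : last z q \notin W by rewrite -in_setC qZ ?mem_last.
have Wl : last x p \in W by rewrite sW ?mem_last.
have Wx : x \in W by rewrite sW ?mem_head.
rewrite (dE (i := last x p)) ?Wl //; last by apply: contraNneq Zz => <-.
rewrite (dE (i := last z q)) ?Wx ?orbT //; last by apply: contraNneq Zl => ->.
by move: sumW; rewrite big_cons; lra.
Qed.

Lemma gauged_normal e : (0 < e <= #|~: W|)%N -> outer_zero W d e ->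
    (#|~: W| = 1%N \/ exists2 e', (e < e' <= #|~: W|)%N & outer_zero W d e') ->
  forall i j, i != j -> d i j = t * ((j \in W)%:R - k%:R * (j == r)%:R -
    (#|W|%:R - k%:R) * exit_coef R W i j).
Proof.
move=> /andP[e_gt0 le_eZ] outer0 extra.
have inZ : {in ~: W &, forall x y, x != y -> d x y = 0}.
  case: extra => [Z1 | [e' /andP[lt_ee' le_e'Z] outer0']].
    move=> x y Zx Zy /negP[]; apply/eqP.
    by have /cards1P[z ZE] := introT eqP Z1; move: Zx Zy; rewrite ZE !inE => /eqP-> /eqP->.
  apply: (@path_sum_eq0 d _ (e' - e)); first by lia.
  (* With a prefix [q] of [e - 1] nodes, stopping at [x] gives a path on [e] nodes and continuing
     along [p] one on [e'] nodes. Both have the same value in [gauged_outer], so the arcs along [p]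
     sum to 0. *)
  move=> x p Uxp xpZ szp.
  have szqp : (e.-1 + size (x :: p) <= #|~: W|)%N by apply: leq_trans le_e'Z; rewrite /= szp; lia.
  have [q [Uq szq qZ]] := uniq_seq_extend Uxp xpZ szqp.
  have Us : uniq (q ++ x :: p) by rewrite uniq_catC.
  have sZ : {subset q ++ x :: p <= ~: W}.
    by move=> i; rewrite mem_cat orbC -mem_cat => /qZ.
  have szs : size (q ++ x :: p) = e' by rewrite size_cat /= szq szp; lia.
  have Us' : uniq (q ++ [:: x]).
    by move: Us; rewrite -cat1s catA cat_uniq => /and3P[].
  have sZ' : {subset q ++ [:: x] <= ~: W}.
    by move=> i iqx; apply: sZ; rewrite -cat1s catA mem_cat iqx.
  have szs' : size (q ++ [:: x]) = e by rewrite size_cat /= szq; lia.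
  have e'_gt0 : (0 < e')%N by lia.
  case: q Us sZ szs Us' sZ' szs' {Uq szq qZ} => [|z q] Us sZ szs Us' sZ' szs'.
    have := gauged_outer e_gt0 outer0 Us' sZ' szs'.
    have := gauged_outer e'_gt0 outer0' Us sZ szs.
    by rewrite /=; lra.
  have := gauged_outer e_gt0 outer0 Us' sZ' szs'.
  have := gauged_outer e'_gt0 outer0' Us sZ szs.
  by rewrite !path_sum_cat /=; lra.
have tauZ z : z \in ~: W -> tau z = - ((#|W|%:R - k%:R) * t).
  move=> Zz; have zZ : {subset [:: z] <= ~: W} by move=> i; rewrite inE => /eqP->.
  have sze : (e.-1 + size [:: z] <= #|~: W|)%N by rewrite addn1 prednK.
  have [q [Uzq szq zqZ]] := uniq_seq_extend (isT : uniq [:: z]) zZ sze.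
  have szzq : size (z :: q) = e by rewrite /= szq prednK.
  rewrite -(gauged_outer e_gt0 outer0 Uzq zqZ szzq).
  rewrite (path_sum_head (tau := fun=> 0) Uzq) ?big1 ?addr0 // => i j iZ jZ.
  by apply: inZ; apply: zqZ.
move=> i j ij; rewrite /exit_coef.
have [Wj | Zj] := boolP (j \in W).
  by rewrite dE ?Wj ?orbT // tauE //= andbF /=; ring.
have jr : (j == r) = false by apply: contraNF Zj => /eqP->.
have [Wi | Zi] := boolP (i \in W).
  by rewrite dE ?Wi // tauZ ?in_setC // jr /=; ring.
by rewrite inZ ?in_setC // jr /=; ring.
Qed.

End Gauged.

(** Charging the right-hand side [2 * k] to the arc leaving the root makes the inequality
    homogeneous on cycles through [r]. *)
Lemma tight_normal_form b e : inner_zero b -> (0 < e <= #|~: W|)%N ->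
    outer_zero W b e ->
    (#|~: W| = 1%N \/ exists2 e', (e < e' <= #|~: W|)%N & outer_zero W b e') ->
  exists phi t, forall i j, i != j -> b i j =
    phi i - phi j + t * (subgraph_coef R W k i j - 2 * k%:R * (i == r)%:R).
Proof.
move=> inner0 eZ outer0 extra.
have [|phi [psi bE]] := outer_separable eZ _ outer0; first by lia.
pose d i j := b i j - (phi i - phi j).
have sum_d s : uniq s -> cycle_sum d s = cycle_sum b s.
  by move=> Us; rewrite /cycle_sum sumrB [X in _ - X](cycle_sum_potential phi Us) subr0.
have outer_d e1 : outer_zero W b e1 -> outer_zero W d e1.
  move=> outer1 u q Uu uW szu Uq qZ szq.
  by rewrite sum_d; [exact: outer1 | exact: (cat_uniq_setC Uu Uq uW qZ)].
have inner_d : inner_zero d by move=> s Us sr sW szs; rewrite sum_d ?inner0.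
have dE i j : i != j -> (i \in W) || (j \in W) -> d i j = psi j + phi j.
  by move=> ij WiWj; rewrite /d bE //; ring.
have [t tauE] := gauged_inner dE inner_d.
have extra_d : #|~: W| = 1%N \/
    exists2 e', (e < e' <= #|~: W|)%N & outer_zero W d e'.
  by case: extra => [|[e' ? ?]]; [left | right; exists e'; last exact: outer_d].
have normal := gauged_normal dE tauE eZ (outer_d _ outer0) extra_d.
pose D : R := #|W|%:R - k%:R.
(* This potential moves the root term from heads to tails and redistributes the indicator of [W]
   between heads and tails as in [subgraph_coef_potential]. *)
pose chi i : R := t * (k%:R * (i == r)%:R - (1 + D) / 2 * (i \in W)%:R).
exists (fun i => phi i + chi i), (t / 2) => i j ij.
have := normal i j ij; rewrite /d => /eqP; rewrite subr_eq => /eqP->.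
rewrite subgraph_coef_potential -/D /chi; by field.
Qed.

End NormalForm.

(** * Entries of a cardinality sequence *)

Section CardinalitySequence.
Implicit Types (c : seq nat) (p x : nat).

Lemma entry_mem c p : (0 < p <= size c)%N -> entry c p \in c.
Proof. by case: p => // p /= lt_pc; apply: mem_nth. Qed.

Lemma entry_ltn c p p' : sorted ltn c -> (0 < p)%N -> (p < p' <= size c)%N ->
  (entry c p < entry c p')%N.
Proof.
case: p p' => [|p] [|p'] //= sc _ /andP[lt_pp' le_p'c].
by apply: (sorted_ltn_nth ltn_trans 0%N sc); rewrite ?inE //; lia.
Qed.

Lemma entry_dichotomy c p x : sorted ltn c -> (0 < p)%N -> x \in c ->
  (x <= entry c p)%N || (entry c p.+1 <= x)%N.
Proof.
case: p => // p sc _ /(nthP 0%N)[i lt_ic <-]; rewrite /entry /=.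
have sc' := ltn_sorted_uniq_leq c; rewrite sc in sc'.
have /andP[_ lec] := esym sc'.
have mono := sorted_leq_nth leq_trans leqnn 0%N lec.
(* Past the end, [entry] is the default 0 and the second alternative is trivial. *)
have [lt_pc|le_cp] := ltnP p (size c); last first.
  by rewrite [nth _ _ p.+1]nth_default ?orbT // ltnW.
have [le_ip | lt_pi] := leqP i p; first by rewrite mono.
by rewrite (mono p.+1) ?orbT // inE (leq_ltn_trans lt_pi).
Qed.

Lemma entry_le_last c x : sorted ltn c -> x \in c -> (x <= entry c (size c))%N.
Proof.
move=> sc /(nthP 0%N)[i lt_ic <-]; have [/eqP <-|] := boolP (i.+1 == size c) => //.
move=> neq; apply/ltnW/(@entry_ltn c i.+1) => //.
by rewrite leqnn andbT ltn_neqAle neq.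
Qed.

End CardinalitySequence.

(** * Criteria for inducing a facet and for not inducing one *)

Section Facet.
Variables (R : realFieldType) (n : nat) (c : seq nat) (W : {set 'I_n}) (k : nat).
Variable r : 'I_n.
Notation arcvec := {ffun darc n -> R^o}.
Notation P := (@cycle_polytope_through R n r c).
Notation lhs := (@cardsubgraph_lhs R n W k).
Notation rhs := (2 * k%:R : R).
Notation coef := (subgraph_coef R W k).
Implicit Types (s : seq 'I_n) (v x : arcvec) (b : 'I_n -> 'I_n -> R).

Definition rooted_cycle s := [&& uniq s, (1 < size s)%N, r \in s & size s \in c].

Lemma cycle_lhs s : uniq s -> (1 < size s)%N ->
  lhs (incidence R (cycle_arcs s)) = cycle_sum coef s.
Proof. by move=> Us szs; rewrite cardsubgraph_lhsE arc_functional_incidence. Qed.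

Lemma rooted_cycle_polytope s : rooted_cycle s -> P (incidence R (cycle_arcs s)).
Proof.
by case/and4P=> Us szs sr cs; split;
  [apply: cycle_polytope_cycle | apply: delta_out_cycle].
Qed.

(** Let [B] be a basis of the span of the tight cycles. A functional vanishing on [B] and [y0] is
    [t * (coef - rhs)] on the polytope, and [y0] forces [t = 0]; so [y0 :: B] spans the polytope,
    and the dimensions are [size B] and [size B - 1]. *)
Lemma induces_facet_of_normal_form s0 :
    (forall b, (forall s, rooted_cycle s -> cycle_sum coef s = rhs ->
        cycle_sum b s = 0) ->
      exists phi t, forall i j, i != j ->
        b i j = phi i - phi j + t * (coef i j - 2 * k%:R * (i == r)%:R)) ->
    rooted_cycle s0 -> cycle_sum coef s0 != rhs ->
  induces_facet P lhs rhs.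
Proof.
move=> normal s0P s0_loose; pose y0 : arcvec := incidence R (cycle_arcs s0).
have Py0 : P y0 := rooted_cycle_polytope s0P.
have fy0 : arc_functional coef y0 != rhs.
  by case/and4P: s0P => *; rewrite /y0 arc_functional_incidence.
(* Cycles have at most [n] nodes, so bounded sequences make the tight ones a finite list. *)
pose tight (w : n.-bseq 'I_n) := rooted_cycle w && (cycle_sum coef w == rhs).
pose T := [seq incidence R (cycle_arcs (bseqval w)) | w <- enum tight].
have memT s : rooted_cycle s -> cycle_sum coef s = rhs ->
    incidence R (cycle_arcs s) \in T.
  move=> sP fs; have szs : (size s <= n)%N.
    by case/and4P: sP => Us *; rewrite -(card_uniqP Us) -[n in (_ <= n)%N]card_ord max_card.
  by apply/mapP; exists (Bseq szs) => //; rewrite mem_enum unfold_in /tight /= sP fs eqxx.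
have [B [sBT freeB sTB]] := free_subseq_span T.
have Bface v : v \in B -> face P lhs rhs v.
  move/sBT => /mapP[w]; rewrite mem_enum => /andP[sP /eqP fs] ->.
  split; first exact: rooted_cycle_polytope.
  by case/and4P: sP => *; rewrite cycle_lhs.
have spanP x : P x -> x \in <<y0 :: B>>%VS.
  move=> [Px x1]; apply/negPn/negP => /ffun_separation[beta [beta0 betax]].
  pose b i j := if insub (i, j) is Some a then beta a else 0.
  have bE v : arc_functional b v = \sum_a beta a * v a.
    apply: eq_bigr => a _; rewrite /b -surjective_pairing valK //.
  have [s sP fs|phi [t bphi]] := normal b.
    have := sP; case/and4P=> Us szs _ _; rewrite -arc_functional_incidence // bE.
    apply: beta0; have := sTB _ (memT s sP fs); apply/subvP.
    by rewrite span_cons addvSr.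
  have bP v : P v -> arc_functional b v = t * (arc_functional coef v - rhs).
    move=> [Pv v1]; rewrite arc_sum_delta_out in v1.
    transitivity (arc_functional (fun i j => phi i - phi j) v + t *
        (arc_functional coef v - rhs * arc_functional (fun j _ => (j == r)%:R) v)).
      rewrite (eq_arc_functional _ bphi) /arc_functional.
      rewrite mulr_sumr -sumrB mulr_sumr -big_split /=.
      by apply: eq_bigr => a _; ring.
    by rewrite (cycle_polytope_potential phi Pv) v1 mulr1 add0r.
  have /eqP : t * (arc_functional coef y0 - rhs) = 0.
    by rewrite -bP // bE beta0 // memv_span ?mem_head.
  rewrite mulf_eq0 subr_eq0 (negPf fy0) orbF => /eqP t0.
  by case/negP: betax; rewrite -bE bP // t0 mul0r.
pose out1 := arc_functional (fun j _ => (j == r)%:R) : {scalar arcvec}.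
have outP x : P x -> out1 x = 1 by case=> _; rewrite arc_sum_delta_out.
exists (size B)%:Z; split.
  exists (size B).+1; split; first by lia.
    exists (extend_family (fun i : 'I_(size B) => B`_i) y0); split.
      by apply: extend_family_forall => // i; have [] := Bface _ (mem_nth 0 (ltn_ord i)).
    apply: (extend_affinely_independent (f := arc_functional coef) (r := rhs)) => //.
      exact: free_affinely_independent.
    move=> i; have [_] := Bface _ (mem_nth 0 (ltn_ord i)).
    by rewrite cardsubgraph_lhsE.
  move=> j v Pv indep_v; apply: (affinely_independent_leq_span (f := out1) indep_v (X := y0 :: B)).
    by move=> i; apply: outP.
  by move=> i; apply: spanP.
exists (size B); split; first by [].
  exists (fun i : 'I_(size B) => B`_i); split; last exact: free_affinely_independent.
  by move=> i; apply: Bface; apply: mem_nth.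
(* Adding [y0], which is off the face, turns the bound for the polytope into the bound for the
   face. *)
move=> j v Fv indep_v.
have indep_vy : affinely_independent (extend_family v y0).
  apply: (extend_affinely_independent (f := arc_functional coef) (r := rhs)) => //.
  by move=> i; have [_] := Fv i; rewrite cardsubgraph_lhsE.
have Pvy i : P (extend_family v y0 i).
  by apply: extend_family_forall => // o; have [] := Fv o.
rewrite -ltnS; apply: (affinely_independent_leq_span (f := out1) indep_vy (X := y0 :: B)).
  by move=> i; apply: outP.
by move=> i; apply: spanP.
Qed.

(* Every cycle on the face satisfies the further equation
   [size s - (k' - k) * exits s = k]; together with the inequality it is combined
   with the coefficients [l] and [m] into a functional that separates [s1]. *)
Lemma not_induces_facet k' (l m : R) s1 s2 :
    (forall s, size s \in c -> (size s <= k)%N || (#|W| < size s)%N) ->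
    (forall s, size s \in c -> (#|W| < size s)%N -> size s = k') ->
    (0 < k < #|W|)%N ->
    let G s : R := (size s)%:R - (k'%:R - k%:R) * (exits W s)%:R in
    rooted_cycle s1 -> rooted_cycle s2 -> cycle_sum coef s2 != rhs ->
    l * cycle_sum coef s2 + m * G s2 = l * rhs + m * k%:R ->
    l * cycle_sum coef s1 + m * G s1 != l * rhs + m * k%:R ->
  ~ induces_facet P lhs rhs.
Proof.
move=> gap top k_range G s1P s2P F2 G2 G1.
pose h i j := l * coef i j + m * (1 - (k'%:R - k%:R) * exit_coef R W i j).
have hE s : cycle_sum h s = l * cycle_sum coef s + m * G s.
  rewrite /G -(cycle_sum_exit R) /cycle_sum big_split /= -!mulr_sumr; congr (_ + _ * _).
  by rewrite sumrB -mulr_sumr big_const_seq count_predT iter_addr_0.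
have rootedE b s : rooted_cycle s ->
    arc_functional b (incidence R (cycle_arcs s)) = cycle_sum b s.
  by case/and4P=> *; apply: arc_functional_incidence.
pose y s : arcvec := incidence R (cycle_arcs s).
move=> [d [[N [dN _ maxN]] [N' [dN' [v [Fv indep_v]] _]]]].
have coefv i : arc_functional coef (v i) = rhs.
  by have [_] := Fv i; rewrite cardsubgraph_lhsE.
have hv i : arc_functional h (v i) = l * rhs + m * k%:R.
  have [[Pv _] _] := Fv i.
  apply: (convex_hull_face (f := arc_functional coef) _ _ Pv (coefv i)).
    move=> _ [F [/simple_dicycleP[s [Us szs ->]] cs ->]].
    rewrite (card_cycle_arcs R) // in cs.
    rewrite /= arc_functional_incidence // cycle_sum_subgraph_le ?gap //.
    by case/andP: k_range.
  move=> _ [F [/simple_dicycleP[s [Us szs ->]] cs ->]].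
  rewrite (card_cycle_arcs R) // in cs.
  rewrite /= !arc_functional_incidence // => fs; rewrite hE fs /G; congr (_ + m * _).
  have [[szk ->]|[szW ->]] := cycle_sum_subgraph_eq Us k_range (gap _ cs) fs.
    by rewrite szk; ring.
  by rewrite (top _ cs szW); ring.
(* A maximal family on the face grows by [s2], off the face but on the hyperplane of [h], and then
   by [s1], off that hyperplane: two more points, where a facet allows only one. *)
have indep1 : affinely_independent (extend_family v (y s2)).
  apply: (extend_affinely_independent (f := arc_functional coef) (r := rhs)) => //.
  by rewrite /= rootedE.
have indep2 : affinely_independent (extend_family (extend_family v (y s2)) (y s1)).
  apply: (extend_affinely_independent (f := arc_functional h)
            (r := l * rhs + m * k%:R)) => //; last by rewrite /= rootedE // hE.
  apply: (extend_family_forall (P := fun x => arc_functional h x = _)) => //.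
  by rewrite /= rootedE // hE.
have Pv2 i : P (extend_family v (y s2) i).
  by apply: extend_family_forall; [move=> o; have [] := Fv o | apply: rooted_cycle_polytope].
have Pv12 i : P (extend_family (extend_family v (y s2)) (y s1) i).
  by apply: extend_family_forall => //; apply: rooted_cycle_polytope.
have := maxN _ _ Pv12 indep2.
by lia.
Qed.

End Facet.

(** * Explicit cycles through the root *)

Section RootedCycles.
Variables (R : realFieldType) (n : nat) (c : seq nat) (W : {set 'I_n}) (k : nat).
Variables (r : 'I_n) (Wr : r \in W).
Notation coef := (subgraph_coef R W k).
Implicit Types (s u q : seq 'I_n).

(** For [a < #|W|] these cycles are not tight, which supplies points off the face. *)
Lemma exists_one_exit_cycle a e : (0 < a <= #|W|)%N -> (0 < e <= #|~: W|)%N ->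
    (a + e)%N \in c -> exists s, [/\ rooted_cycle c r s, size s = (a + e)%N,
    exits W s = 1%N & cycle_sum coef s = 2 * (a%:R - #|W|%:R + k%:R)].
Proof.
move=> /andP[a_gt0 le_aW] /andP[e_gt0 le_eZ] c_ae.
have rW : {subset [:: r] <= W} by move=> i; rewrite inE => /eqP->.
have szu : (a.-1 + size [:: r] <= #|W|)%N by rewrite addn1 prednK.
have [u [Uru szur ruW]] := uniq_seq_extend (isT : uniq [:: r]) rW szu.
have [[|y q] [Uyq szyq yqZ]] := uniq_seq_of_card le_eZ.
  by rewrite -szyq in e_gt0.
have Us := cat_uniq_setC Uru Uyq ruW yqZ; rewrite cat1s in Us ruW.
have szs : size ((r :: u) ++ y :: q) = (a + e)%N.
  by rewrite size_cat szyq /= szur prednK.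
exists ((r :: u) ++ y :: q); split=> //.
- by rewrite /rooted_cycle Us szs mem_head c_ae andbT; lia.
- exact: (exits_eq1 R Us ruW yqZ).
by rewrite (cycle_sum_subgraph_cat _ _ Us ruW yqZ) szur prednK.
Qed.

Lemma exists_two_exit_cycle : (1 < #|W|)%N -> (1 < #|~: W|)%N -> n \in c ->
  exists s, [/\ rooted_cycle c r s, size s = n, exits W s = 2%N &
    cycle_sum coef s = 2 * (2 * k%:R - #|W|%:R)].
Proof.
move=> W_gt1 Z_gt1 c_n.
have rW : {subset [:: r] <= W} by move=> i; rewrite inE => /eqP->.
have szW : (#|W|.-1 + size [:: r] <= #|W|)%N by rewrite addn1 prednK // ltnW.
have [[|x p] [Uru szxp rxpW]] := uniq_seq_extend (isT : uniq [:: r]) rW szW.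
  by move: szxp W_gt1 => /=; lia.
have [[|z [|y q]] [Uzyq szzyq zyqZ]] := uniq_seq_of_card (leqnn #|~: W|).
- by move: Z_gt1; rewrite -szzyq.
- by move: Z_gt1; rewrite -szzyq.
have Us0 := cat_uniq_setC Uru Uzyq rxpW zyqZ.
(* One node of [W], one outside, the rest of [W], the rest outside: a Hamiltonian cycle with two
   exits. *)
pose s := r :: z :: (x :: p) ++ y :: q.
have perm_s : perm_eq ([:: r] ++ (x :: p) ++ [:: z] ++ y :: q) s.
  by rewrite perm_cons perm_catCA.
have Us : uniq s by rewrite -(perm_uniq perm_s) catA.
have szs : size s = n.
  transitivity (#|W| + #|~: W|)%N; last by rewrite cardsC card_ord.
  rewrite -(perm_size perm_s) !size_cat szxp -szzyq /=.
  by rewrite add1n add1n -addSn prednK // ltnW.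
have Zz : z \in W = false by apply: negbTE; rewrite -in_setC zyqZ ?mem_head.
have Zy : y \in W = false.
  by apply: negbTE; rewrite -in_setC zyqZ ?inE ?eqxx ?orbT.
have Zl : last y q \in W = false.
  by apply: negbTE; rewrite -in_setC zyqZ // inE mem_last orbT.
have Wx : x \in W by rewrite rxpW ?inE ?eqxx ?orbT.
have Wl : last x p \in W by rewrite rxpW // inE mem_last orbT.
have [Ux Uy] : uniq (x :: p) /\ uniq (y :: q).
  by move: Uru Uzyq => /= /andP[_ ->] /andP[_ ->].
have exits2 : exits W s = 2%N.
  apply/eqP; rewrite -(eqr_nat R) -cycle_sum_exit cycle_sum_cons //=.
  rewrite rcons_cat path_sum_cat /= path_sum_rcons.
  rewrite (path_sum_head (tau := fun=> 0) Ux); last first.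
    by move=> i j _ pj _; rewrite /exit_coef (rxpW j) ?andbF // mem_cat pj orbT.
  rewrite (path_sum_head (tau := fun=> 0) Uy); last first.
    move=> i j qi _ _; rewrite /exit_coef.
    by have := zyqZ i; rewrite inE qi orbT in_setC => /(_ isT) /negPf->.
  rewrite /exit_coef Wr Zz Wl Zy Zl !big1 //=.
  by apply/eqP; ring.
exists s; split=> //.
  rewrite /rooted_cycle Us szs mem_head c_n andbT.
  by rewrite -szs.
rewrite cycle_sum_subgraph // exits2.
have -> : count (mem W) s = #|W|.
  rewrite -(permP perm_s) !count_cat.
  have -> : count (mem W) (x :: p) = size (x :: p).
    apply/eqP; rewrite -all_count; apply/allP => i xpi; apply: rxpW.
    by rewrite mem_cat xpi orbT.
  have -> : count (mem W) [:: z] = 0%N by rewrite /= Zz.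
  have -> : count (mem W) (y :: q) = 0%N.
    apply/eqP; rewrite eqn0Ngt -has_count; apply/hasPn => i yqi.
    by have := zyqZ i; rewrite inE yqi orbT in_setC => /(_ isT).
  by rewrite szxp /= Wr !addn0 add1n prednK // ltnW.
by ring.
Qed.

Lemma rooted_tight_normal_form b e : (1 < k < #|W|)%N -> k \in c ->
    (0 < e <= #|~: W|)%N -> (#|W| + e)%N \in c ->
    (#|~: W| = 1%N \/ exists2 e', (e < e' <= #|~: W|)%N & (#|W| + e')%N \in c) ->
    (forall s, rooted_cycle c r s -> cycle_sum coef s = 2 * k%:R ->
      cycle_sum b s = 0) ->
  exists phi t, forall i j, i != j ->
    b i j = phi i - phi j + t * (coef i j - 2 * k%:R * (i == r)%:R).
Proof.
move=> k_range ck eZ c_e extra b0.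
have outer e1 : (0 < e1)%N -> (#|W| + e1)%N \in c -> outer_zero W b e1.
  move=> e1_gt0 c_e1 u q Uu uW szu Uq qZ szq.
  have Us := cat_uniq_setC Uu Uq uW qZ.
  have ru : r \in u.
    have suW : {subset u <= enum W} by move=> i /uW; rewrite mem_enum.
    have leWu : (size (enum W) <= size u)%N by rewrite -cardE szu.
    by have [_ ->] := uniq_min_size Uu suW leWu; rewrite mem_enum.
  have szs : size (u ++ q) = (#|W| + e1)%N by rewrite size_cat szu szq.
  apply: b0.
    rewrite /rooted_cycle Us szs c_e1 mem_cat ru /= andbT.
    have /andP[k_gt1 lt_kW] := k_range.
    by rewrite (leq_trans k_gt1) // (leq_trans (ltnW lt_kW)) ?leq_addr.
  case: u ru Us uW szu {Uu szs} => // x p ru Us uW szu.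
  case: q Us qZ szq {Uq} => [|y q] Us qZ szq; first by rewrite -szq in e1_gt0.
  by rewrite (cycle_sum_subgraph_cat _ _ Us uW qZ) -szu /= subrr add0r.
have inner : inner_zero W k r b.
  move=> s Us sr sW szs; apply: b0.
    by rewrite /rooted_cycle Us sr szs ck !andbT; case/andP: k_range.
  by rewrite cycle_sum_subgraph_inside ?szs.
apply: (tight_normal_form Wr k_range inner eZ).
  by apply: outer => //; case/andP: eZ.
case: extra => [|[e' e'Z c_e']]; [by left | right; exists e' => //].
by apply: outer => //; lia.
Qed.

End RootedCycles.

(** * Validity of the inequality and characterisation of the facet case *)

Theorem theorem7 (R : realFieldType) (n : nat) (n_gt0 : (0 < n)%N)
    (c : seq nat) (c_card : cardinality_sequence n c)
    (W : {set 'I_n}) (W1 : Ordinal n_gt0 \in W)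
    (p : nat) (p_range : (1 <= p <= size c - 1)%N)
    (W_card : (entry c p < #|W| < entry c p.+1)%N) :
  let Pstar := @cycle_polytope_through R n (Ordinal n_gt0) c in
  let lhs := @cardsubgraph_lhs R n W (entry c p) in
  let rhs : R := 2 * (entry c p)%:R in
  valid_ineq Pstar lhs rhs /\
  ((2 <= entry c p)%N ->
   (induces_facet Pstar lhs rhs <->
    (p.+1 < size c)%N \/ (entry c p.+1 = n /\ n = #|W|.+1))).
Proof.
have /andP[sorted_c /allP c_le] := c_card.
have [p_gt0 lt_pc] : (0 < p)%N /\ (p < size c)%N by lia.
set k := entry c p in W_card *; set k' := entry c p.+1 in W_card *.
have [lt_kW lt_Wk'] := andP W_card.
have ck : k \in c by apply: entry_mem; lia.
have ck' : k' \in c by apply: entry_mem; lia.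
have le_k'n : (k' <= n)%N by case/andP: (c_le _ ck').
have gap (s : seq 'I_n) : size s \in c -> (size s <= k)%N || (#|W| < size s)%N.
  by move=> cs; have := entry_dichotomy sorted_c p_gt0 cs; rewrite -/k -/k'; lia.
have cardZ : (#|W| + #|~: W| = n)%N by rewrite cardsC card_ord.
move=> Pstar lhs rhs; split.
  move=> x [Px _]; rewrite /lhs cardsubgraph_lhsE.
  apply: (convex_hull_le (f := arc_functional (subgraph_coef R W k))) Px.
  move=> _ [F [/simple_dicycleP[s [Us szs ->]] cs ->]].
  rewrite (card_cycle_arcs R) // in cs.
  by rewrite /= arc_functional_incidence // cycle_sum_subgraph_le ?gap.
move=> k_gt1.
have c_k1 : (k.-1 + 1)%N \in c by rewrite addn1 prednK // ltnW.
have k1_range : (0 < k.-1 <= #|W|)%N by lia.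
have Z_gt0 : (0 < 1 <= #|~: W|)%N by lia.
(* The cycle [s1] has [k - 1 > 0] nodes in [W] and one outside; it is the point off the face used in
   both directions. *)
have [s1 [s1P sz1 ex1 F1]] := exists_one_exit_cycle R k W1 k1_range Z_gt0 c_k1.
have k1E : k.-1%:R = k%:R - 1 :> R by rewrite -subn1 natrB // ltnW.
have lt_kWR : k%:R < #|W|%:R :> R by rewrite ltr_nat.
split; last first.
  move=> facet_cond.
  have [e [eZ c_e extra]] : exists e, [/\ (0 < e <= #|~: W|)%N, (#|W| + e)%N \in c &
      #|~: W| = 1%N \/ exists2 e', (e < e' <= #|~: W|)%N & (#|W| + e')%N \in c].
    (* The outer paths come from the length [k'] and, when it exists, from the next entry of [c]. *)
    exists (k' - #|W|)%N; rewrite subnKC; last exact: ltnW.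
    split=> //; first by lia.
    case: facet_cond => [lt_p1c | [? ?]]; last by left; lia.
    right; have c2 : entry c p.+2 \in c by apply: entry_mem.
    have lt2 : (k' < entry c p.+2)%N by apply: entry_ltn => //; lia.
    have le2 : (entry c p.+2 <= n)%N by case/andP: (c_le _ c2).
    by exists (entry c p.+2 - #|W|)%N; [lia | rewrite subnKC //; lia].
  apply: (induces_facet_of_normal_form _ s1P).
    move=> b b0; apply: (rooted_tight_normal_form W1 _ ck eZ c_e extra b0).
    by rewrite k_gt1.
  by rewrite F1 k1E; apply/eqP; lra.
move=> facet; have [lt_p1c | le_cp1] := ltnP p.+1 (size c); [by left | right].
have top (s : seq 'I_n) : size s \in c -> (#|W| < size s)%N -> size s = k'.
  move=> cs szs; have := entry_dichotomy sorted_c p_gt0 cs.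
  have := entry_le_last sorted_c cs; have -> : size c = p.+1 by lia.
  by rewrite -/k -/k'; lia.
have k_range : (0 < k < #|W|)%N by rewrite ltnW.
have lt_kk' := ltn_trans lt_kW lt_Wk'.
have lt_kk'R : k%:R < k'%:R :> R by rewrite ltr_nat.
have W_gt1 := ltn_trans k_gt1 lt_kW.
(* If [k' < n], there is room for a cycle of length [k'] with one exit that misses one node of [W].
   It is not tight but satisfies the second equation, which [s1] violates; hence [l = 0] and
   [m = 1]. *)
have [lt_k'n | le_nk'] := ltnP k' n.
  exfalso.
  have a_range : (0 < #|W|.-1 <= #|W|)%N by rewrite leq_pred andbT -ltnS prednK // ltnW.
  have le_Wk' : (#|W|.-1 <= k')%N := leq_trans (leq_pred _) (ltnW lt_Wk').
  have e_range : (0 < k' - #|W|.-1 <= #|~: W|)%N by lia.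
  have c_ae : (#|W|.-1 + (k' - #|W|.-1))%N \in c by rewrite subnKC.
  have [s2 [s2P sz2 ex2 F2]] := exists_one_exit_cycle R k W1 a_range e_range c_ae.
  have W1E : #|W|.-1%:R = #|W|%:R - 1 :> R by rewrite -subn1 natrB // ltnW.
  apply: (not_induces_facet (l := 0) (m := 1) gap top k_range s1P s2P) facet.
  - by rewrite F2 W1E; apply/eqP; lra.
  - by rewrite sz2 ex2 subnKC //; ring.
  rewrite sz1 ex1 addn1 prednK; last exact: ltnW.
  rewrite !mul0r !add0r !mul1r mulr1 -subr_eq0 addrAC subrr sub0r oppr_eq0.
  by rewrite subr_eq0 gt_eqF.
have k'n : k' = n by apply/eqP; rewrite eqn_leq le_k'n.
split=> //; apply/eqP; apply: contraT => neq_nW; exfalso.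
have Z_gt1 : (1 < #|~: W|)%N by lia.
have c_n : n \in c by rewrite -k'n.
have [s2 [s2P sz2 ex2 F2]] := exists_two_exit_cycle R k W1 W_gt1 Z_gt1 c_n.
(* At [s2] the two equations are off by [- 2 (#|W| - k)] and [- (n - k)]; these multipliers cancel
   the errors, while at [s1] they leave [- (n - k)]. *)
apply: (not_induces_facet (l := (n%:R - k%:R) / 2) (m := - (#|W|%:R - k%:R))
          gap top k_range s1P s2P) facet.
- by rewrite F2; apply/eqP; lra.
- by rewrite F2 sz2 ex2 k'n; field.
rewrite F1 sz1 ex1 k1E addn1 prednK ?k'n; last exact: ltnW.
have -> : (n%:R - k%:R) / 2 * (2 * (k%:R - 1 - #|W|%:R + k%:R)) +
   - (#|W|%:R - k%:R) * (k%:R - (n%:R - k%:R) * 1) =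
   (n%:R - k%:R) / 2 * (2 * k%:R) + - (#|W|%:R - k%:R) * k%:R - (n%:R - k%:R) :> R.
  by field.
by apply/eqP; rewrite k'n in lt_kk'R; lra.
Qed.
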